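(* Let ${\bf E}$ be an $n$-dimensional nilpotent evolution algebra over $\mathbb K$ with maximal index of nilpotency, with fixed natural basis $\{{\bf e}_1,\dots,{\bf e}_n\}$ in normal form, and let $R$ be a Rota-Baxter operator of weight $\theta\in\mathbb K$ on ${\bf E}$, with matrix $(r_{i,j})_{i,j=1}^n$ given by $R({\bf e}_i)=\sum_{k=1}^n r_{i,k}{\bf e}_k$. Then $R$ is upper triangular, i.e. $r_{i,j}=0$ whenever $j<i$.
   Context: $\mathbb K$ is $\mathbb R$ or $\mathbb C$. An evolution algebra over $\mathbb K$ is a vector space ${\bf E}$ with a bilinear multiplication and a basis $\{{\bf e}_i\}$ (a natural basis) such that ${\bf e}_i{\bf e}_j={\bf 0}$ for $i\ne j$ (and ${\bf e}_i^2$ is a linear combination of basis vectors). ''Nilpotent with maximal index of nilpotency'' means ${\bf E}$ is nilpotent with $\dim({\bf E}\cdot{\bf E})=n-1$; throughout, for such ${\bf E}$ a natural basis in normal form is fixed, meaning ${\bf e}_i^2=\sum_{j=i+1}^{n}a_{i,j}{\bf e}_j$ for $i<n$ and ${\bf e}_n^2={\bf 0}$, where $a_{i,j}\in\mathbb K$, $a_{i,i+1}=1$ for all $i<n$, and $a_{i,n}=0$ for all $i\le n-2$. A linear map $R:{\bf E}\to{\bf E}$ is a Rota-Baxter operator of weight $\theta$ if $R({\bf x})R({\bf y})=R(R({\bf x}){\bf y}+{\bf x}R({\bf y})+\theta{\bf x}{\bf y})$ for all ${\bf x},{\bf y}\in{\bf E}$. *)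

(* Defs.v *)
From HB Require Import structures.
From mathcomp Require Import all_boot all_order all_algebra.
From mathcomp Require Import sesquilinear complex.
From mathcomp Require Import reals.

Set Implicit Arguments.
Unset Strict Implicit.
Unset Printing Implicit Defensive.

Import GRing.Theory.
Local Open Scope ring_scope.

(* [real_or_complex F K]: the scalar field [K] is the real field [F] itself or
   its field of complex numbers. *)
Inductive real_or_complex (F : realType) : fieldType -> Prop :=
| RealScalars : real_or_complex F F
| ComplexScalars : real_or_complex F F[i]%C.

(* MathComp has no structure for non-associative algebras: an algebra is a
   finite-dimensional vector space [E] with a bilinear map [mul]. *)
Section Algebra.
Variables (K : fieldType) (E : vectType K) (mul : {bilinear E -> E -> E}).

Definition alg_prod (U V : {vspace E}) : {vspace E} :=
  <<[seq mul u v | u <- vbasis U, v <- vbasis V]>>%VS.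

Lemma mem_alg_prod (U V : {vspace E}) u v :
  u \in U -> v \in V -> mul u v \in alg_prod U V.
Proof.
move=> /coord_vbasis-> /coord_vbasis->.
rewrite linear_sumlz memv_suml // => i _; rewrite linear_sumr memv_suml // => j _.
rewrite linearZl_LR linearZr_LR !memvZ // memv_span //.
by apply/allpairsP; exists ((vbasis U)`_i, (vbasis V)`_j);
  rewrite !mem_nth ?size_tuple.
Qed.

Lemma alg_prod_sub (U V W : {vspace E}) :
  (forall u v, u \in U -> v \in V -> mul u v \in W) ->
  (alg_prod U V <= W)%VS.
Proof.
move=> UVW; apply/span_subvP => _ /allpairsP[[u v] /= [uU vV ->]].
by apply: UVW; apply: vbasis_mem.
Qed.

(* [:: E^1; ...; E^k], where E^1 = E and
   E^m = E^1 E^(m-1) + E^2 E^(m-2) + ... + E^(m-1) E^1. *)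
Fixpoint alg_powers (k : nat) : seq {vspace E} :=
  if k is m.+1 then
    let s := alg_powers m in
    rcons s (if m is 0 then fullv
             else \sum_(i < m) alg_prod (nth 0%VS s i)
                                        (nth 0%VS s (m - i.+1)))%VS
  else [::].

Definition alg_power (k : nat) : {vspace E} := nth 0%VS (alg_powers k) k.-1.

Lemma size_alg_powers k : size (alg_powers k) = k.
Proof. by elim: k => //= k IHk; rewrite size_rcons IHk. Qed.

Lemma nth_alg_powers k i : (i < k)%N ->
  nth 0%VS (alg_powers k) i = alg_power i.+1.
Proof.
elim: k => // k IHk; rewrite ltnS leq_eqVlt => /predU1P[-> //|lt_ik].
by rewrite /= nth_rcons size_alg_powers lt_ik IHk.
Qed.

Lemma alg_power1 : alg_power 1 = fullv.
Proof. by []. Qed.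

Lemma alg_powerE m : (1 < m)%N ->
  alg_power m =
    (\sum_(1 <= i < m) alg_prod (alg_power i) (alg_power (m - i)))%VS.
Proof.
case: m => [|[|m]] // _; rewrite big_add1 big_mkord.
rewrite {1}/alg_power [alg_powers m.+2]/= -/(alg_powers m.+1).
rewrite nth_rcons size_alg_powers ltnn eqxx.
apply: eq_bigr => i _; rewrite !nth_alg_powers //; last first.
  by rewrite subSS ltnS leq_subr.
by rewrite -subSn.
Qed.

(* Powers start at E^1: [alg_power 0] is only the default value 0. *)
Definition nilpotent_alg : Prop :=
  exists2 k : nat, (0 < k)%N & alg_power k = 0%VS.

(* dim (E E) = n - 1 is stated without truncated subtraction. *)
Definition max_nilpotent_alg : Prop :=
  nilpotent_alg /\ (\dim (alg_prod fullv fullv)).+1 = \dim {:E}.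

Definition natural_basis (n : nat) (e : n.-tuple E) : Prop :=
  basis_of fullv e /\
  forall i j : 'I_n, i != j -> mul (tnth e i) (tnth e j) = 0.

(* Indices run from 0 to n - 1 instead of 1 to n. *)
Definition normal_form (n : nat) (e : n.-tuple E) (a : 'M[K]_n) : Prop :=
  [/\ forall i : 'I_n, (i.+1 < n)%N ->
        mul (tnth e i) (tnth e i) = \sum_(j < n | (i < j)%N) a i j *: tnth e j,
      forall i : 'I_n, i.+1 = n -> mul (tnth e i) (tnth e i) = 0,
      forall i j : 'I_n, j = i.+1 :> nat -> a i j = 1
    & forall i j : 'I_n, (i.+2 < n)%N -> j.+1 = n -> a i j = 0].

Definition rota_baxter (theta : K) (R : {linear E -> E}) : Prop :=
  forall x y : E,
    mul (R x) (R y) = R (mul (R x) y + mul x (R y) + theta *: mul x y).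

End Algebra.

(* Main.v *)
Require Import Defs.
From mathcomp Require Import all_boot all_order all_algebra.
From mathcomp Require Import sesquilinear complex.
From mathcomp Require Import reals.

Set Implicit Arguments.
Unset Strict Implicit.
Unset Printing Implicit Defensive.

Import GRing.Theory.
Local Open Scope ring_scope.

(** The operator is triangular because it preserves the flag of ideals spanned
    by the last basis vectors.  Suppose that the span of the [e_m] with [m > i]
    is [R]-invariant.  It contains [e_i^2], so the Rota-Baxter identity at
    [(e_i, e_i)],
      [\sum_k r_ik^2 e_k^2 = (2 r_ii + theta) R (e_i^2)],
    shows that [\sum_k r_ik^2 e_k^2] lies in it too.  But [e_k^2] is [e_(k+1)]
    plus later basis vectors, so the [e_k^2] with [k < i] are linearly
    independent modulo that span.  Hence [r_ik^2 = 0] for all [k < i], and the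
    span of the [e_m] with [m >= i] is invariant as well.  Descending induction
    on [i] starts at the zero subspace. *)

Section NaturalBasis.
Variables (K : fieldType) (n : nat) (E : vectType K).
Variables (mul : {bilinear E -> E -> E}) (e : n.-tuple E).

Lemma coord_tnth (i j : 'I_n) : free e -> coord e i (tnth e j) = (j == i)%:R.
Proof. by move=> e_free; rewrite (tnth_nth 0) coord_free. Qed.

Lemma coord_lincomb (P : pred 'I_n) (x : 'I_n -> K) (i : 'I_n) : free e ->
  coord e i (\sum_(k | P k) x k *: tnth e k) = if P i then x i else 0.
Proof.
move=> e_free; rewrite linear_sum /= big_mkcond (bigD1 i) //= big1 ?addr0.
  by rewrite linearZ /= coord_tnth // eqxx mulr1.
move=> k ki; rewrite linearZ /= coord_tnth // (negPf ki) mulr0.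
by case: ifP.
Qed.

Lemma natural_basis_mul_lincomb (x y : 'I_n -> K) : natural_basis mul e ->
  mul (\sum_k x k *: tnth e k) (\sum_k y k *: tnth e k) =
    \sum_k (x k * y k) *: mul (tnth e k) (tnth e k).
Proof.
case=> _ orth; rewrite linear_sumlz; apply: eq_bigr => k _.
rewrite linear_sumr (bigD1 k) //= big1 ?addr0 => [|l lk].
  by rewrite linearZl_LR linearZr_LR scalerA.
by rewrite linearZl_LR linearZr_LR orth ?scaler0 // eq_sym.
Qed.

(** The last basis vector fits the general formula because the sum is then
    empty, so it needs no separate case later. *)
Lemma normal_form_sqr (a : 'M[K]_n) (i : 'I_n) : normal_form mul e a ->
  mul (tnth e i) (tnth e i) = \sum_(j < n | (i < j)%N) a i j *: tnth e j.
Proof.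
case=> sqr sqr_last _ _; have [/sqr //|last_i] := ltnP i.+1 n.
have iE : i.+1 = n by apply/eqP; rewrite eqn_leq ltn_ord.
rewrite sqr_last // big_pred0 // => j.
by apply/negbTE; rewrite -leqNgt -ltnS iE.
Qed.

(** One entry of the matrix: the coordinate at [j + 1 <= i] of the Rota-Baxter
    identity at [(e_i, e_i)] is [r_ij^2 = 0].  On the left the terms [k < j]
    vanish by assumption and those with [k > j] have no such coordinate; on the
    right the coordinate is a combination of entries [r_(m, j+1)] with
    [m > i]. *)
Lemma rota_baxter_entry_eq0 (a r : 'M[K]_n) (theta : K) (R : {linear E -> E})
    (i j : 'I_n) :
  natural_basis mul e -> normal_form mul e a -> rota_baxter mul theta R ->
  (forall k, R (tnth e k) = \sum_l r k l *: tnth e l) -> (j < i)%N ->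
  (forall m l : 'I_n, (i < m)%N -> (l < m)%N -> r m l = 0) ->
  (forall k : 'I_n, (k < j)%N -> r i k = 0) ->
  r i j = 0.
Proof.
move=> he ha hR hr ji rows_below row_left.
have e_free : free e by case: he => /basis_free.
have [_ _ superdiag _] := ha.
pose q : 'I_n := Ordinal (leq_ltn_trans ji (ltn_ord i)).
have left_coord :
    coord e q (mul (R (tnth e i)) (R (tnth e i))) = r i j ^+ 2.
  rewrite hr natural_basis_mul_lincomb // linear_sum (bigD1 j) //= big1.
    rewrite addr0 linearZ /= (normal_form_sqr _ ha) coord_lincomb //=.
    by rewrite ltnSn superdiag // mulr1.
  move=> k kj; rewrite linearZ /= (normal_form_sqr _ ha) coord_lincomb //=.
  have [lt_kj|le_jk] := ltnP k j; first by rewrite row_left // !mul0r.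
  have jk : (j < k)%N by rewrite ltn_neqAle le_jk eq_sym andbT.
  by rewrite ltnS leqNgt jk mulr0.
have right_coord : coord e q (R (mul (tnth e i) (tnth e i))) = 0.
  rewrite (normal_form_sqr _ ha) linear_sum linear_sum big1 //= => m im.
  rewrite !linearZ /= hr coord_lincomb //= rows_below ?mulr0 //=.
  exact: leq_ltn_trans ji im.
(* Off-diagonal products vanish, so the argument of [R] is a multiple of
   [e_i^2]. *)
have cross : mul (R (tnth e i)) (tnth e i) = r i i *: mul (tnth e i) (tnth e i)
          /\ mul (tnth e i) (R (tnth e i)) = r i i *: mul (tnth e i) (tnth e i).
  case: he => _ orth; rewrite hr linear_sumlz linear_sumr.
  split; rewrite (bigD1 i) //= big1 ?addr0 ?linearZl_LR ?linearZr_LR // => l li;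
    by rewrite ?linearZl_LR ?linearZr_LR /= orth ?scaler0 // eq_sym.
have [crossl crossr] := cross.
have := congr1 (coord e q) (hR (tnth e i) (tnth e i)).
rewrite left_coord crossl crossr -!scalerDl !linearZ /= right_coord mulr0 => /eqP.
by rewrite sqrf_eq0 => /eqP.
Qed.

End NaturalBasis.

Theorem lemma3p1 (F : realType) (K : fieldType) (hK : real_or_complex F K)
  (n : nat) (E : vectType K) (mul : {bilinear E -> E -> E})
  (hnil : max_nilpotent_alg mul)
  (e : n.-tuple E) (he : natural_basis mul e)
  (a : 'M[K]_n) (ha : normal_form mul e a)
  (theta : K) (R : {linear E -> E}) (hR : rota_baxter mul theta R)
  (r : 'M[K]_n)
  (hr : forall i : 'I_n, R (tnth e i) = \sum_(k < n) r i k *: tnth e k) :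
  forall i j : 'I_n, (j < i)%N -> r i j = 0.
Proof.
move=> i; have [d] := ubnP (n - i); elim: d i => // d IHd i le_d j.
(* Row [i]: increasing induction on the column, all lower rows being known. *)
have [p] := ubnP (nat_of_ord j); elim: p j => // p IHp j le_p ji.
apply: (rota_baxter_entry_eq0 he ha hR hr ji) => [m l im|k kj].
  by apply: IHd => //; apply: leq_trans (ltn_sub2l (ltn_ord i) im) _.
apply: IHp; [exact: leq_trans kj le_p | exact: ltn_trans kj ji].
Qed.
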